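(* Let $m < 0$ be a squarefree integer, let $K = \mathbb{Q}(\sqrt{m}\,)$, let $D_m$ be the ring of integers of $K$, and let $\Delta$ be the discriminant of $K$. Assume that $\left(\frac{\Delta}{p}\right) = -1$ for all prime numbers $p$ with $2 \le p \le \sqrt{-\Delta/3}$. Then $D_m$ is a principal ideal domain.
   Context: The discriminant is $\Delta = m$ if $m \equiv 1 \bmod 4$ and $\Delta = 4m$ if $m \equiv 2, 3 \bmod 4$. The symbol $\left(\frac{\Delta}{p}\right)$ is the Kronecker symbol: for odd primes $p$ it is the Legendre symbol (equal to $0$ if $p \mid \Delta$), and for $p = 2$ it equals $0$ if $\Delta$ is even, $+1$ if $\Delta \equiv 1 \bmod 8$, and $-1$ if $\Delta \equiv 5 \bmod 8$. *)

(* Defs.v *)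
(* MathComp world. *)
From HB Require Import structures.
From mathcomp Require Import all_boot all_order all_algebra all_field.
From mathcomp Require Import boolp.

Set Implicit Arguments.
Unset Strict Implicit.
Unset Printing Implicit Defensive.

Import Order.TTheory GRing.Theory Num.Theory.

Local Open Scope ring_scope.

Definition is_ideal (R : comNzRingType) (I : R -> Prop) : Prop :=
  [/\ I 0,
      forall x y, I x -> I y -> I (x + y)
    & forall a x, I x -> I (a * x)].

Definition is_principal (R : comNzRingType) (I : R -> Prop) : Prop :=
  exists g : R, forall x, I x <-> exists a, x = a * g.

(* Nontriviality (1 != 0) is part of comNzRingType. *)
Definition is_pid (R : comNzRingType) : Prop :=
  (forall x y : R, x * y = 0 -> x = 0 \/ y = 0) /\
  (forall I : R -> Prop, is_ideal I -> is_principal I).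

Section RingOfIntegers.

Variable K : fieldExtType rat.

(* integralOver is Prop-valued; `[< _ >] turns it into a boolean predicate so
   that the subtype machinery applies. *)
Definition alg_integer : {pred K} :=
  fun x => `[< integralOver (intr : int -> K) x >].

Lemma alg_integerP (x : K) :
  reflect (integralOver (intr : int -> K) x) (x \in alg_integer).
Proof. exact: asboolP. Qed.

Fact alg_integer_subring : subring_closed alg_integer.
Proof.
split=> [|x y|x y]; first by apply/alg_integerP; apply: integral1.
- by move=> /alg_integerP ix /alg_integerP iy; apply/alg_integerP/integral_sub.
- by move=> /alg_integerP ix /alg_integerP iy; apply/alg_integerP/integral_mul.
Qed.

HB.instance Definition _ :=
  GRing.isSubringClosed.Build K alg_integer alg_integer_subring.

Record ring_of_integers := RingOfIntegers {
  ring_of_integers_val :> K;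
  _ : ring_of_integers_val \in alg_integer
}.

HB.instance Definition _ := [isSub for ring_of_integers_val].
HB.instance Definition _ := [Choice of ring_of_integers by <:].
HB.instance Definition _ :=
  [SubChoice_isSubComNzRing of ring_of_integers by <:].

End RingOfIntegers.

Definition squarefree (m : int) : Prop :=
  forall d : int, (d ^+ 2 %| m)%Z -> d \is a GRing.unit.

(* For m squarefree, the discriminant of Q(sqrt m); m = 2, 3 mod 4 are then
   the only other cases. *)
Definition quad_disc (m : int) : int :=
  if (m == 1 %[mod 4])%Z then m else 4 * m.

Definition legendre (D : int) (p : nat) : int :=
  if (p %| D)%Z then 0
  else if [exists x : 'I_p, (x%:Z ^+ 2 == D %[mod p])%Z] then 1 else -1.

(* The symbol (D / p) for p prime.  At p = 2 it is the usual value for every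
   odd D; an odd discriminant is 1 mod 4, so for it the two cases are 1 and 5
   mod 8. *)
Definition kronecker (D : int) (p : nat) : int :=
  if p == 2%N then
    if (2 %| D)%Z then 0
    else if (D == 1 %[mod 8])%Z || (D == 7 %[mod 8])%Z then 1 else -1
  else legendre D p.

(* Main.v *)
Require Import Defs.
From mathcomp Require Import all_boot all_order all_algebra all_field.
From mathcomp Require Import boolp zify ring lra.
Import Order.TTheory GRing.Theory Num.Theory.
Local Open Scope ring_scope.

(** Let [e] be the discriminant, [t = sqrt e / 2] and [w = t + e / 2].  Divide
    a nonzero ideal by an element [g] of minimal norm: this gives a lattice [J]
    that contains [1], is stable under [w], and has no nonzero element of norm
    below 1.  Then [J] has a basis [1, tau] with [tau = (e / 2 + l + t) / k],
    and translating [tau] so that its rational part is at most 1/2 in absolute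
    value, [norm tau >= 1] gives [3 k^2 <= - e].  Stability under [w] forces
    [k] to divide the norm of [l + w], that is [(e + 2 l)^2 - e = 4 k z].  A prime
    factor [p] of [k] would make [e] a square modulo [p] (modulo 8 if [p = 2]),
    contrary to its inertness; so [k = 1], and the ideal is generated by [g]. *)

(** * Lattices in the plane that contain 1 and are stable under [w] *)

Lemma near_int (a : rat) :
  exists z : int, -(1 / 2%:R) <= a - z%:~R <= 1 / 2%:R.
Proof.
exists (Num.floor (a + 1 / 2%:R)).
have /andP[] := floor_itv (a + 1 / 2%:R); rewrite intrD => h1 h2.
by apply/andP; split; lra.
Qed.

Lemma subgroup_mulz (J : rat -> rat -> Prop) :
  (forall a b a' b', J a b -> J a' b' -> J (a - a') (b - b')) ->
  forall (z : int) a b, J a b -> J (z%:~R * a) (z%:~R * b).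
Proof.
move=> Jsub z a b Jab.
have J0 : J 0 0 by have := Jsub _ _ _ _ Jab Jab; rewrite !subrr.
have JN x y : J x y -> J (- x) (- y).
  by move=> Jxy; have := Jsub _ _ _ _ J0 Jxy; rewrite !sub0r.
have Jnat n : J (n%:R * a) (n%:R * b).
  elim: n => [|n IHn]; first by rewrite !mul0r.
  have := Jsub _ _ _ _ IHn (JN _ _ Jab).
  by rewrite !opprK -addn1 natrD !mulrDl !mul1r.
case: (intP z) => [|n|n]; first by rewrite !mul0r.
  exact: Jnat.
by rewrite mulrNz !mulNr; apply: JN; apply: Jnat.
Qed.

(* [J] is a lattice in the plane, [J a b] standing for [a + b t] with
   [t ^+ 2 = e / 4]; its third closure property is multiplication by
   [t + e / 2].  The conclusion gives the basis [1], [(e / 2 + l + t) / k]. *)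
Lemma lattice_basis (e D : int) (J : rat -> rat -> Prop) :
  0 < D -> J 1 0 ->
  (forall a b a' b', J a b -> J a' b' -> J (a - a') (b - b')) ->
  (forall a b, J a b ->
     J (a * e%:~R / 2%:R + b * e%:~R / 4%:R) (a + b * e%:~R / 2%:R)) ->
  (forall a b, J a b -> (a != 0) || (b != 0) ->
     1 <= a ^+ 2 - e%:~R / 4%:R * b ^+ 2) ->
  (forall a b, J a b -> exists z : int, D%:~R * b = z%:~R) ->
  exists k l z : int,
    [/\ 0 < k, 3%:R * k ^+ 2 <= - e,
        (e + 2%:R * l) ^+ 2 - e = 4%:R * k * z
      & forall a b, J a b -> exists x y : int,
          b * k%:~R = y%:~R /\ a = x%:~R + b * (e%:~R / 2%:R + l%:~R)].
Proof.
move=> D0 J1 Jsub Jmul Jnorm Jden.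
have Jz := subgroup_mulz J Jsub.
have D0r : 0 < D%:~R :> rat by rewrite ltr0z.
have Dn0 : D%:~R != 0 :> rat by rewrite gt_eqF.
have J01 : J (e%:~R / 2%:R) 1.
  by have := Jmul _ _ J1; rewrite !mul1r !mul0r !addr0.
(* By [Jden] the second coordinates lie in [1 / D] times the integers, so there is a least positive
   one, [b0 = n / D]. *)
pose P n := (0 < n)%N && `[< exists a, J a (n%:R / D%:~R) >].
have exP : exists n, P n.
  exists `|D|%N; apply/andP; split; first by rewrite absz_gt0 gt_eqF.
  apply/asboolP; exists (e%:~R / 2%:R).
  by rewrite natr_absz gtr0_norm // divff.
case: (ex_minnP exP) => n /andP[n0 /asboolP[a1 Ja1]] nmin.
have [z1 a0le] := near_int a1.
set a0 := a1 - z1%:~R in a0le.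
set b0 : rat := n%:R / D%:~R in Ja1.
have Ja0 : J a0 b0.
  have := Jsub _ _ _ _ Ja1 (Jz z1 _ _ J1).
  by rewrite mulr1 mulr0 subr0.
have n0r : 0 < n%:R :> rat by rewrite ltr0n.
have b0gt : 0 < b0 by rewrite divr_gt0.
(* Euclidean division: a nonzero remainder would give a positive second coordinate below [b0]. *)
have mulb0 a b : J a b -> exists q : int, b = q%:~R * b0.
  move=> Jab; have [z Dbz] := Jden _ _ Jab.
  have nz : (n : int) != 0 by rewrite -lt0n.
  exists (z %/ n)%Z.
  have Jr := Jsub _ _ _ _ Jab (Jz (z %/ n)%Z _ _ Ja0).
  have r_ge0 : 0 <= (z %% n)%Z by rewrite modz_ge0.
  have r_lt : (z %% n)%Z < n by rewrite ltz_pmod.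
  case: (z %% n)%Z (divz_eq z n) r_ge0 r_lt => // r zE _ r_lt.
  have rE : b - (z %/ n)%Z%:~R * b0 = r%:R / D%:~R.
    have -> : b = z%:~R / D%:~R by rewrite -Dbz mulrAC divff // mul1r.
    by rewrite /b0 {1}zE intrD intrM -!pmulrn; field.
  case: (posnP r) => [r0|r_gt0].
    by apply/eqP; rewrite -subr_eq0 rE r0 mul0r.
  have /nmin : P r by rewrite /P r_gt0; apply/asboolP; eexists; rewrite -rE; exact: Jr.
  by rewrite leqNgt -ltz_nat r_lt.
(* Subtracting the nearest integer leaves a rational element of norm at most 1/4, hence zero. *)
have Jreal a : J a 0 -> exists x : int, a = x%:~R.
  move=> Ja; have [z az] := near_int a; exists z.
  have Jaz := Jsub _ _ _ _ Ja (Jz z _ _ J1).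
  rewrite mulr0 mulr1 subr0 in Jaz.
  apply/eqP; rewrite -subr_eq0; apply/eqP; apply: contrapT => /eqP nz.
  by have := Jnorm _ _ Jaz; rewrite nz => /(_ isT); nra.
(* Since [w] has second coordinate 1, this gives [b0 = 1 / k]. *)
have [k kb0] := mulb0 _ _ J01.
have k0 : 0 < k.
  have : 0 < k%:~R * b0 by rewrite -kb0.
  by rewrite pmulr_lgt0 // ltr0z.
have k0r : 0 < k%:~R :> rat by rewrite ltr0z.
(* With [tau = a0 + b0 t], the difference [w - k tau] has no [t]-part, so it is an integer. *)
have [l' l'E] : exists x : int, e%:~R / 2%:R - k%:~R * a0 = x%:~R.
  apply: Jreal; have := Jsub _ _ _ _ J01 (Jz k _ _ Ja0).
  by rewrite -kb0 subrr.
have a0E : a0 = b0 * (e%:~R / 2%:R + (- l')%:~R).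
  by rewrite intrN -l'E opprB addrC subrK mulrA [b0 * _]mulrC -kb0 mul1r.
(* The multiplier [e - l'] cancels the [t]-part of [w tau]. The integer that remains is
   [- ((e - 2 l') ^+ 2 - e) / (4 k)], which explains the witnesses [- l'] and [- z] below. *)
have [z zE] : exists x : int,
    a0 * e%:~R / 2%:R + b0 * e%:~R / 4%:R - (e - l')%:~R * a0 = x%:~R.
  apply: Jreal.
  have := Jsub _ _ _ _ (Jmul _ _ Ja0) (Jz (e - l') _ _ Ja0).
  suff -> : a0 + b0 * e%:~R / 2%:R - (e - l')%:~R * b0 = 0 by [].
  by rewrite a0E intrD intrN; field.
exists k, (- l'), (- z); split=> //.
- have b0_neq0 : b0 != 0 by rewrite gt_eqF.
  have := Jnorm _ _ Ja0; rewrite b0_neq0 orbT => /(_ isT) norm_ge1.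
  (* Here [a0 ^+ 2 <= 1 / 4] leaves at least 3/4 for the term in [b0]. *)
  have b0b : 3%:R <= - e%:~R * b0 ^+ 2 by nra.
  have : 3%:R * k%:~R ^+ 2 <= - e%:~R * (k%:~R * b0) ^+ 2 :> rat.
    by rewrite exprMn [leRHS]mulrCA [leLHS]mulrC ler_pM2l ?exprn_gt0.
  by rewrite -kb0 expr1n mulr1 -(ler_int rat) intrM intrN rmorphXn.
- apply: (@intr_inj rat).
  rewrite !(rmorphB, rmorphM, rmorphXn, rmorphD, rmorphN) /= -zE a0E.
  rewrite !(intrD, intrN).
  have -> : b0 = k%:~R^-1.
    by apply: (mulfI (lt0r_neq0 k0r)); rewrite -kb0 mulfV ?gt_eqF.
  by field; rewrite gt_eqF.
- move=> a b Jab; have [y yE] := mulb0 _ _ Jab.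
  have [x xE] : exists x : int, a - y%:~R * a0 = x%:~R.
    by apply: Jreal; have := Jsub _ _ _ _ Jab (Jz y _ _ Ja0); rewrite -yE subrr.
  exists x, y; split.
    by rewrite yE -mulrA [b0 * _]mulrC -kb0 mulr1.
  by rewrite yE -mulrA -a0E -xE subrK.
Qed.

(** * Inert primes and the index [k] *)

Lemma sqrz_mod8 (x : int) : ~~ (2 %| x)%Z -> (x ^+ 2 = 1 %[mod 8])%Z.
Proof.
move=> xodd.
have : (x %% 8)%Z \in [:: 1; 3; 5; 7 : int].
  have x2 : ~~ (2 %| x %% 8)%Z.
    apply: contra xodd => /dvdzP[q qE]; rewrite (divz_eq x 8) qE.
    by apply/dvdzP; exists ((x %/ 8)%Z * 4 + q); ring.
  have : 0 <= (x %% 8)%Z < 8 by rewrite modz_ge0 // ltz_pmod.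
  by move: x2; case: (x %% 8)%Z => // n; do 8 ?[case: n => [|n] //].
rewrite -modzXm !inE => /or4P[] /eqP ->; exact: erefl.
Qed.

(** The equation would make [e] a square modulo [4 p]. For [p = 2] the symbol forces [e] odd, so the
    square is 1 modulo 8 and so is [e]. *)
Lemma inert_coprime_norm (e l z : int) (p : nat) :
  prime p -> kronecker e p = -1 ->
  (e + 2%:R * l) ^+ 2 - e <> 4%:R * p%:Z * z.
Proof.
move=> p_pr; rewrite /kronecker; case: eqP => [->|p2] + eqz.
- case: ifPn => // e2.
  have sq1 : ((e + 2%:R * l) ^+ 2 = 1 %[mod 8])%Z by apply: sqrz_mod8; lia.
  suff -> : (e == 1 %[mod 8])%Z by [].
  rewrite -sq1 eqz_mod_dvd; apply/dvdzP; exists (- z).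
  by rewrite -[LHS]opprB eqz; ring.
- rewrite /legendre; case: ifP => // _; case: ifPn => // /existsP[].
  have p0 : (p : int) != 0 by rewrite -lt0n prime_gt0.
  have m_ge0 : 0 <= ((e + 2%:R * l) %% p)%Z by rewrite modz_ge0.
  have m_lt : ((e + 2%:R * l) %% p)%Z < p by rewrite ltz_pmod // ltz_nat prime_gt0.
  case mE: ((e + 2%:R * l) %% p)%Z m_ge0 m_lt => [n|//] _ n_lt.
  exists (Ordinal n_lt) => /=.
  rewrite -mE modzXm eqz_mod_dvd eqz; apply/dvdzP; exists (4%:R * z); ring.
Qed.

(** If [k > 1], its least prime factor is at most [k], so it inherits the bound and is inert, while
    it also divides the right-hand side. *)
Lemma inert_index_eq1 (e k l z : int) :
  (forall p : nat, prime p -> 3%:R * p%:Z ^+ 2 <= - e -> kronecker e p = -1) ->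
  0 < k -> 3%:R * k ^+ 2 <= - e -> (e + 2%:R * l) ^+ 2 - e = 4%:R * k * z ->
  k = 1.
Proof.
case: k => // k inert k_gt0 ke eqz.
have [k_le1|k_gt1] := leqP k 1.
  by congr Posz; apply/eqP; rewrite eqn_leq k_le1.
have p_pr := pdiv_prime k_gt1.
have /dvdnP[q kE] := pdiv_dvd k.
have p_le : (pdiv k <= k)%N by apply: dvdn_leq (pdiv_dvd k).
have pe : 3%:R * (pdiv k)%:Z ^+ 2 <= - e by nia.
case: (@inert_coprime_norm e l (q%:Z * z) _ p_pr (inert _ p_pr pe)).
by rewrite eqz {1}kE PoszM; ring.
Qed.

(** * The discriminant and coordinates with respect to 1 and [t] *)

Lemma quad_disc_lt0 (m : int) : m < 0 -> quad_disc m < 0.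
Proof. by rewrite /quad_disc; case: ifP => // _; lia. Qed.

(** The integer [c] is the norm of [w], whose trace is the discriminant; this is what makes [w]
    integral. *)
Lemma quad_disc_mod4 (m : int) :
  exists c : int, quad_disc m ^+ 2 - quad_disc m = 4%:R * c.
Proof.
rewrite /quad_disc; case: ifP => [m1|_]; last first.
  by exists (4%:R * m ^+ 2 - m); ring.
have [q ->] : exists q, m = 1 + 4 * q by exists (m %/ 4)%Z; lia.
by exists (4 * q ^+ 2 + q); ring.
Qed.

(** Using half a square root of the discriminant treats both residue cases alike: [t] is [s / 2] if
    [m] is 1 modulo 4, and [s] otherwise. *)
Lemma quad_disc_sqrt (m : int) (K : fieldExtType rat) (s : K) :
  s ^+ 2 = m%:~R ->
  exists (c : rat) (t : K),
    s = c%:A * t /\ t ^+ 2 = ((quad_disc m)%:~R / 4%:R)%:A.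
Proof.
move=> s2; rewrite /quad_disc; case: ifP => _.
  exists 2%:R, ((1 / 2%:R)%:A * s); split.
    by rewrite mulrA -(rmorphM (in_alg K)) /= divff // scale1r mul1r.
  rewrite exprMn s2 -(rmorphXn (in_alg K)) -(rmorph_int (in_alg K)) -(rmorphM (in_alg K)) /=.
  by congr (_%:A); field.
exists 1, s; split; first by rewrite scale1r mul1r.
rewrite s2 -(rmorph_int (in_alg K)) /= intrM; congr (_%:A); by field.
Qed.

(** Every element is a polynomial in [s]; Horner's scheme evaluates it, with [t ^+ 2] replaced by
    [d] at each step. *)
Lemma quad_coords (K : fieldExtType rat) (s : K) (c d : rat) (t x : K) :
  <<1; s>>%VS = fullv -> s = c%:A * t -> t ^+ 2 = d%:A ->
  exists a b : rat, x = a%:A + b%:A * t.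
Proof.
move=> gen sE t2.
have /Fadjoin_poly_eq <- : x \in <<1; s>>%VS by rewrite gen memvf.
have /polyOver1P[q ->] := Fadjoin_polyOver 1%AS s x.
elim/poly_ind: q => [|q r [a [b IHq]]].
  by exists 0, 0; rewrite rmorph0 horner0 !scale0r mul0r addr0.
exists (b * c * d + r), (a * c).
rewrite rmorphD rmorphM /= map_polyX map_polyC /= hornerMXaddC IHq sE.
have -> : (a%:A + b%:A * t) * (c%:A * t) + r%:A =
    a%:A * c%:A * t + (b%:A * c%:A * t ^+ 2 + r%:A) by ring.
by rewrite t2 -!(rmorphM (in_alg K)) -(rmorphD (in_alg K)) addrC.
Qed.

Lemma quad_norm (K : fieldExtType rat) (d : rat) (t : K) (a b : rat) :
  t ^+ 2 = d%:A ->
  (a ^+ 2 - d * b ^+ 2)%:A = (a%:A + b%:A * t) * (a%:A - b%:A * t).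
Proof.
move=> t2.
have -> : (a%:A + b%:A * t) * (a%:A - b%:A * t) =
  a%:A ^+ 2 - t ^+ 2 * b%:A ^+ 2 by ring.
rewrite t2 -!(rmorphXn (in_alg K)) -(rmorphM (in_alg K)).
by rewrite -(rmorphB (in_alg K)).
Qed.

(** For [d < 0] the norm form is positive definite. *)
Lemma quad_eq0 (K : fieldExtType rat) (d : rat) (t : K) (a b : rat) :
  d < 0 -> t ^+ 2 = d%:A -> a%:A + b%:A * t = 0 -> a = 0 /\ b = 0.
Proof.
move=> d_lt0 t2 ab0.
have : (a ^+ 2 - d * b ^+ 2)%:A = 0 :> K.
  by rewrite (quad_norm _ _ _ _ _ t2) ab0 mul0r.
move/eqP; rewrite -[_ *: 1]/(in_alg K _) fmorph_eq0 => /eqP N0.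
by split; apply/eqP; rewrite -sqrf_eq0; apply/eqP; nra.
Qed.

(** * Integrality, conjugates, trace and norm *)

(** The monic relation descends to [rat] and is carried into [algC], where rational algebraic
    integers are integers. *)
Lemma alg_integer_rat (K : fieldExtType rat) (q : rat) :
  (q%:A : K) \in @alg_integer K -> exists z : int, q = z%:~R.
Proof.
move=> /alg_integerP[p p_mon p0].
have p0q : root (map_poly intr p) q.
  move: p0; rewrite /root.
  have -> : map_poly intr p = map_poly (in_alg K) (map_poly intr p).
    by rewrite -map_poly_comp; apply: eq_map_poly => i /=; rewrite -(rmorph_int (in_alg K)).
  by rewrite -[q%:A]/(in_alg K q) horner_map fmorph_eq0.
have : (ratr q : algC) \in Aint.
  apply: (@root_monic_Aint (map_poly intr p)).
  - have -> : map_poly intr p = map_poly (ratr : rat -> algC) (map_poly intr p).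
      by rewrite -map_poly_comp; apply: eq_map_poly => i /=; rewrite ratr_int.
    by rewrite /root horner_map fmorph_eq0.
  - by rewrite monic_map.
  - by apply/polyOverP => i; rewrite coef_map /= intr_int.
move/(Cint_rat_Aint (Crat_rat q))/intrP=> [z zE]; exists z.
by apply: (fmorph_inj (ratr : {rmorphism rat -> algC})); rewrite /= zE ratr_int.
Qed.

Lemma alg_integer_conj (K : fieldExtType rat) (d : rat) (t : K) (a b : rat) :
  d < 0 -> t ^+ 2 = d%:A ->
  a%:A + b%:A * t \in @alg_integer K -> a%:A - b%:A * t \in @alg_integer K.
Proof.
move=> d_lt0 t2 /alg_integerP[p p_mon p0]; apply/alg_integerP; exists p => //.
(* In place of a conjugation automorphism: [u] and [v] do not depend on the square root [r] of [d],
   so they serve for both [t] and [- t]. *)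
have [u [v uv]] : exists u v : rat, forall r : K, r ^+ 2 = d%:A ->
    (map_poly intr p).[a%:A + b%:A * r] = u%:A + v%:A * r.
  elim/poly_ind: p {p_mon p0} => [|p c [u [v uv]]].
    by exists 0, 0 => r _; rewrite rmorph0 horner0 !scale0r mul0r addr0.
  exists (u * a + v * b * d + c%:~R), (u * b + v * a) => r r2.
  rewrite rmorphD rmorphM /= map_polyX map_polyC /= hornerMXaddC uv //.
  have -> : (u%:A + v%:A * r) * (a%:A + b%:A * r) + c%:~R =
    u%:A * a%:A + v%:A * b%:A * r ^+ 2 + c%:~R + (u%:A * b%:A + v%:A * a%:A) * r.
    by ring.
  by rewrite r2 -(rmorph_int (in_alg K)) -!(rmorphM (in_alg K)) -!(rmorphD (in_alg K)).
move: p0; rewrite /root uv // => /eqP/(quad_eq0 _ _ _ _ _ d_lt0 t2)[u0 v0].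
by rewrite -mulrN uv ?sqrrN // u0 v0 !scale0r mul0r addr0.
Qed.

Lemma alg_integer_trace_norm (K : fieldExtType rat) (d : rat) (t : K) (a b : rat) :
  d < 0 -> t ^+ 2 = d%:A -> a%:A + b%:A * t \in @alg_integer K ->
  exists y z : int, 2%:R * a = y%:~R /\ a ^+ 2 - d * b ^+ 2 = z%:~R.
Proof.
move=> d_lt0 t2 x_int.
have x'_int := alg_integer_conj _ _ _ _ _ d_lt0 t2 x_int.
have [y yE] : exists y : int, 2%:R * a = y%:~R.
  apply: (alg_integer_rat K); rewrite mulr_natl mulr2n scalerDl.
  by have := rpredD x_int x'_int; rewrite addrACA subrr addr0.
have [z zE] : exists z : int, a ^+ 2 - d * b ^+ 2 = z%:~R.
  apply: (alg_integer_rat K); rewrite (quad_norm _ _ _ _ _ t2).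
  exact: rpredM.
by exists y, z.
Qed.

Lemma alg_integer_quad (K : fieldExtType rat) (e c : int) (x : K) :
  x * (x - e%:~R) + c%:~R = 0 -> x \in @alg_integer K.
Proof.
move=> x0; apply/alg_integerP; exists ('X * ('X - e%:P) + c%:P).
  rewrite monicE lead_coefDl ?lead_coefM ?lead_coefX ?lead_coefXsubC ?mul1r //.
  rewrite size_monicM ?monicX ?polyXsubC_eq0 // size_polyX size_XsubC.
  by rewrite (leq_ltn_trans (size_polyC_leq1 _)).
rewrite /root rmorphD rmorphM rmorphB /= map_polyX !map_polyC /=.
by rewrite !hornerE x0.
Qed.

(** * From an ideal to its lattice and back *)

Theorem corollary3 (m : int) (m_lt0 : m < 0) (m_sqf : squarefree m)
    (K : fieldExtType rat) (s : K) (s_sqrt : s ^+ 2 = m%:~R)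
    (K_gen : <<1; s>>%VS = fullv)
    (inert : forall p : nat, prime p -> (2 <= p)%N ->
       (p%:R : algC) <= sqrtC (- (quad_disc m)%:~R / 3%:R) ->
       kronecker (quad_disc m) p = -1) :
  is_pid (ring_of_integers K).
Proof.
have e_lt0 := quad_disc_lt0 _ m_lt0.
have [c0 c0E] := quad_disc_mod4 m.
have [c [t [sE t2]]] := quad_disc_sqrt _ _ _ s_sqrt.
set e := quad_disc m in inert e_lt0 c0E t2.
have {}inert (p : nat) : prime p -> 3%:R * p%:Z ^+ 2 <= - e -> kronecker e p = -1.
  move=> p_pr pe; apply: inert => //; first exact: prime_gt1.
  have e3 : 0 <= - e%:~R / 3%:R :> algC.
    by rewrite divr_ge0 // oppr_ge0 lerz0 ltW.
  rewrite -(@sqrCK _ p%:R) // ler_sqrtC ?nnegrE ?exprn_ge0 //.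
  rewrite ler_pdivlMr // mulrC.
  by move: pe; rewrite -(ler_int algC) intrM intrN rmorphXn.
have coords x := quad_coords _ _ _ _ _ x K_gen sE t2.
have [d dE] : exists d : rat, e%:~R / 4%:R = d by exists (e%:~R / 4%:R).
rewrite dE in t2 coords.
have d_lt0 : d < 0 by rewrite -dE pmulr_llt0 ?ltrz0.
have eE : e%:~R = 4%:R * d by rewrite -dE; field.
have AD (x y : rat) : (x + y)%:A = x%:A + y%:A :> K := rmorphD (in_alg K) x y.
have AM (x y : rat) : (x * y)%:A = x%:A * y%:A :> K := rmorphM (in_alg K) x y.
have Az (z : int) : z%:~R%:A = z%:~R :> K := rmorph_int (in_alg K) z.
have An (n : nat) : n%:R%:A = n%:R :> K := rmorph_nat (in_alg K) n.
have [h hE] : exists h : rat, e%:~R / 2%:R = h by exists (e%:~R / 2%:R).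
have w_int : t + h%:A \in @alg_integer K.
  apply: (@alg_integer_quad K e c0).
  have -> : (e%:~R : K) = h%:A + h%:A by rewrite -AD -Az; congr (_%:A); rewrite -hE; field.
  have -> : (t + h%:A) * (t + h%:A - (h%:A + h%:A)) = t ^+ 2 - h%:A * h%:A by ring.
  have -> : (c0%:~R : K) = h%:A * h%:A - d%:A.
    rewrite -Az -AM -scalerBl; congr (_%:A).
    have /(congr1 (fun z : int => z%:~R : rat)) := c0E.
    rewrite !(rmorphB, rmorphM, rmorphXn) /= => c0E'.
    by rewrite -hE -dE; lra.
  by rewrite t2; ring.
(* Multiplying by [2 t], a square root of [e], moves the [t]-coordinate into the trace; this will
   bound denominators in [J]. *)
have t_int : 2%:R * t \in @alg_integer K.
  apply: (@alg_integer_quad K 0 (- e)).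
  rewrite subr0 -expr2 exprMn t2 rmorphN /= -Az eE AM An; ring.
split=> [x y xy0|I [I0 ID IM]].
  have /eqP := congr1 val xy0; rewrite rmorphM rmorph0 mulf_eq0.
  by case/orP => /eqP xy; [left|right]; apply: val_inj; rewrite xy rmorph0.
have [I_eq0|] := EM (forall y, I y -> y = 0).
  exists 0 => x; split=> [/I_eq0 ->|[a ->]]; last by rewrite mulr0.
  by exists 0; rewrite mulr0.
move/existsNP => [y0 /not_implyP[Iy0 /eqP y0_neq0]].
pose N (a b : rat) := a ^+ 2 - d * b ^+ 2.
have N_ge0 a b : 0 <= N a b by rewrite /N; nra.
have N_nat (y : ring_of_integers K) a b : val y = a%:A + b%:A * t ->
  exists n : nat, N a b = n%:R.
  move=> yE; have y_int : a%:A + b%:A * t \in @alg_integer K by rewrite -yE; exact: (valP y).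
  have [_ [z [_ zE]]] := alg_integer_trace_norm _ _ _ _ _ d_lt0 t2 y_int.
  move: (N_ge0 a b); rewrite /N zE ler0z; case: z {zE} => // n _.
  by exists n; rewrite -pmulrn.
(* Norms of elements of [I] are natural numbers, so a nonzero element [g] of least norm exists. *)
pose P n := `[< exists y a b, [/\ I y, y != 0, val y = a%:A + b%:A * t
  & N a b = n%:R] >].
have exP : exists n, P n.
  have [a [b y0E]] := coords (val y0).
  have [n nE] := N_nat _ _ _ y0E.
  by exists n; apply/asboolP; exists y0, a, b.
case: (ex_minnP exP) => n /asboolP[g [a1 [b1 [Ig g_neq0 gE Nn]]]] nmin {y0 Iy0 y0_neq0 exP}.
have valB (x y : ring_of_integers K) : val (x - y) = val x - val y by exact: rmorphB.
have valD (x y : ring_of_integers K) : val (x + y) = val x + val y by exact: rmorphD.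
have valz (z : int) : val (z%:~R : ring_of_integers K) = z%:~R by exact: rmorph_int.
have valM (x y : ring_of_integers K) : val (x * y) = val x * val y by exact: rmorphM.
have val_neq0 (y : ring_of_integers K) : (val y != 0) = (y != 0).
  by rewrite -(inj_eq val_inj) rmorph0.
have g0 : val g != 0 by rewrite val_neq0.
have n_gt0 : 0 < n%:R :> rat.
  rewrite lt_neqAle ler0n andbT eq_sym -Nn; apply: contra g0 => /eqP N0.
  rewrite /N in N0.
  have a0 : a1 = 0 by apply/eqP; rewrite -sqrf_eq0; apply/eqP; nra.
  have b0 : b1 = 0 by apply/eqP; rewrite -sqrf_eq0; apply/eqP; nra.
  by rewrite gE a0 b0 !scale0r mul0r addr0.
(* The quotient of [I] by [g], in coordinates. *)
pose J a b := exists2 y, I y & val y = (a%:A + b%:A * t) * val g.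
have J1 : J 1 0 by exists g => //; rewrite scale1r scale0r mul0r addr0 mul1r.
have Jsub a b a' b' : J a b -> J a' b' -> J (a - a') (b - b').
  case=> [y Iy yE] [y' Iy' y'E]; exists (y - y').
    by apply: ID => //; rewrite -mulN1r; apply: IM.
  by rewrite valB yE y'E !scalerBl; ring.
have Jmul a b : J a b ->
    J (a * e%:~R / 2%:R + b * e%:~R / 4%:R) (a + b * e%:~R / 2%:R).
  case=> [y Iy yE]; exists (RingOfIntegers w_int * y); first exact: IM.
  rewrite valM /= yE -!mulrA hE dE !AD !AM.
  have -> : (t + h%:A) * ((a%:A + b%:A * t) * val g) =
    (a%:A * h%:A + b%:A * t ^+ 2 + (a%:A + b%:A * h%:A) * t) * val g by ring.
  by rewrite t2.
have Jmulg a b : (a%:A + b%:A * t) * val g =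
   (a * a1 + d * b * b1)%:A + (a * b1 + b * a1)%:A * t.
  rewrite gE !AD !AM -t2; ring.
have Jnorm a b : J a b -> (a != 0) || (b != 0) ->
    1 <= a ^+ 2 - e%:~R / 4%:R * b ^+ 2.
  rewrite dE -/(N a b) => -[y Iy yE] ab0.
  have y_neq0 : y != 0.
    rewrite -val_neq0 yE mulf_eq0 negb_or g0 andbT.
    apply: contraL ab0 => /eqP /(quad_eq0 _ _ _ _ _ d_lt0 t2)[-> ->].
    by rewrite eqxx.
  rewrite Jmulg in yE; have [n' n'E] := N_nat _ _ _ yE.
  have /nmin : P n' by apply/asboolP; exists y; do 2 eexists; split; eauto.
  rewrite -(ler_nat rat) -n'E -Nn.
  (* Multiplicativity of the norm turns minimality of [N a1 b1] into [N a b >= 1]. *)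
  have -> : N (a * a1 + d * b * b1) (a * b1 + b * a1) = N a b * N a1 b1.
    by rewrite /N; ring.
  by rewrite ler_pMl // Nn.
have Jden a b : J a b -> exists z : int, (- e * n)%:~R * b = z%:~R.
  (* The trace of the integer [y * conj g * 2 t] is [n e b]. *)
  case=> [y Iy yE].
  have g_int : a1%:A + b1%:A * t \in @alg_integer K by rewrite -gE; exact: (valP g).
  have g'_int := alg_integer_conj _ _ _ _ _ d_lt0 t2 g_int.
  have : val y * (a1%:A - b1%:A * t) * (2%:R * t) \in @alg_integer K.
    by apply: rpredM => //; apply: rpredM => //; exact: (valP y).
  have -> : val y * (a1%:A - b1%:A * t) * (2%:R * t) =
      (2%:R * n%:R * b * d)%:A + (2%:R * n%:R * a)%:A * t.
    rewrite yE gE.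
    have -> : (a%:A + b%:A * t) * (a1%:A + b1%:A * t) * (a1%:A - b1%:A * t) =
      (a%:A + b%:A * t) * (N a1 b1)%:A by rewrite -mulrA -(quad_norm _ _ _ _ _ t2).
    by rewrite Nn !AM -t2 !An; ring.
  case/(alg_integer_trace_norm _ _ _ _ _ d_lt0 t2) => z [_ [zE _]].
  by exists (- z); rewrite intrM !intrN -zE eE -pmulrn; ring.
have nz_gt0 : 0 < - e * n by rewrite mulr_gt0 ?oppr_gt0 // ltz_nat -(ltr0n rat).
have [k [l [z [k_gt0 ke eqz Jbasis]]]] := lattice_basis _ _ _ nz_gt0 J1 Jsub Jmul Jnorm Jden.
have k1 := inert_index_eq1 _ _ _ _ inert k_gt0 ke eqz.
exists g => x; split=> [Ix|[a ->]]; last exact: IM.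
have [a [b abE]] := coords (val x / val g).
have Jab : J a b by exists x => //; rewrite -abE divfK.
(* For [k = 1] the basis is 1 and [l + w], both integral, so [val x / val g] lies in the ring of
   integers. *)
have [x0 [y0 [+ aE]]] := Jbasis _ _ Jab.
rewrite k1 mulr1 => bE.
pose w := RingOfIntegers w_int.
exists (x0%:~R + y0%:~R * (l%:~R + w)); apply: val_inj.
have wE : val (x0%:~R + y0%:~R * (l%:~R + w)) =
    x0%:~R + y0%:~R * (l%:~R + (t + h%:A)).
  by rewrite !(valD, valM, valz).
rewrite valM wE -[LHS](divfK g0) abE aE bE hE !(AD, AM) !Az; ring.
Qed.
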